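(* Let $\mathbb{F}$ be a finite field of characteristic $2$ with at least $4$ elements, and let $n\geq 1$. Then every matrix $A\in M_n(\mathbb{F})$ can be written as $A=N+D$ with $N,D\in M_n(\mathbb{F})$, $N^2=0$, and $D$ diagonalizable.
   Context: A matrix $D\in M_n(\mathbb{F})$ is diagonalizable if there exists an invertible $U\in M_n(\mathbb{F})$ such that $U^{-1}DU$ is diagonal. *)

(* Defs.v *)
From HB Require Import structures.
From mathcomp Require Import all_boot all_order all_algebra all_field.
Set Implicit Arguments. Unset Strict Implicit. Unset Printing Implicit Defensive.
Import GRing.Theory.
Local Open Scope ring_scope.

Definition diagonalizable_mx (F : fieldType) (n : nat) (D : 'M[F]_n) : Prop :=
  exists2 U : 'M[F]_n, U \in unitmx & is_diag_mx (invmx U *m D *m U).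

(* Main.v *)
Require Import Defs.
From HB Require Import structures.
From mathcomp Require Import all_boot all_order all_algebra all_field.
From mathcomp Require Import zify ring.
From Stdlib Require Import Classical.
Set Implicit Arguments. Unset Strict Implicit. Unset Printing Implicit Defensive.
Import GRing.Theory.
Local Open Scope ring_scope.

(* The property passes to direct sums, and splitting off kernels of coprime
   factors of the minimal polynomial, then cyclic subspaces in the primary case,
   reduces it to a cyclic A.  Such an A is similar to a matrix with 1 above the
   diagonal, zeros elsewhere outside the diagonal and the last row, and any
   prescribed diagonal whose sum is the trace.  Grouping the indices by parity,
   the block N going from the class of the last index to the other class squares
   to 0, and A - N is block triangular with eigenvalues the diagonal entries; it
   is diagonalizable once the entries used on the two classes are disjoint and
   the last entry differs from all others.  Four field elements suffice for such
   a choice, except for 2 x 2 matrices of trace 0: there A^2 is a scalar c^2 and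
   A - c squares to 0. *)

(** * Similarity and direct sums *)

Definition sq0_diag_sum (F : fieldType) (n : nat) (A : 'M[F]_n) : Prop :=
  exists N D : 'M[F]_n, [/\ A = N + D, N *m N = 0 & diagonalizable_mx D].

Section Decomposition.
Variable F : fieldType.

(** The rows of [P] form an eigenbasis for the action on row vectors; no inverse appears. *)
Lemma diagonalizable_mxP n (D : 'M[F]_n) :
  diagonalizable_mx D <->
  exists2 P : 'M_n, P \in unitmx & exists d, P *m D = diag_mx d *m P.
Proof.
split=> [[U Uu /diag_mxP[d dE]] | [P Pu [d dE]]].
  exists (invmx U); first by rewrite unitmx_inv.
  by exists d; rewrite -dE mulmxK.
exists (invmx P); first by rewrite unitmx_inv.
by rewrite invmxK dE mulmxK // diag_mx_is_diag.
Qed.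

Lemma sq0_diag_sum_sim n (U A B : 'M[F]_n) : U \in unitmx ->
  U *m A = B *m U -> sq0_diag_sum B -> sq0_diag_sum A.
Proof.
move=> Uu UA [N [D [BE N0 /diagonalizable_mxP[P Pu [d dE]]]]].
exists (invmx U *m N *m U), (invmx U *m D *m U); split.
- by rewrite -mulmxDl -mulmxDr -BE -mulmxA -UA mulKmx.
- rewrite !mulmxA mulmxK // -[_ *m N *m N]mulmxA N0; by rewrite mulmx0 mul0mx.
- apply/diagonalizable_mxP; exists (P *m U); first by rewrite unitmx_mul Pu.
  by exists d; rewrite !mulmxA mulmxK // dE.
Qed.

Lemma sq0_diag_sum_block k l (A : 'M[F]_k) (B : 'M[F]_l) :
  sq0_diag_sum A -> sq0_diag_sum B -> sq0_diag_sum (block_mx A 0 0 B).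
Proof.
move=> [N [D [-> N0 /diagonalizable_mxP[P Pu [d dE]]]]].
move=> [N' [D' [-> N'0 /diagonalizable_mxP[P' P'u [d' d'E]]]]].
exists (block_mx N 0 0 N'), (block_mx D 0 0 D'); split.
- by rewrite add_block_mx !addr0.
- by rewrite mulmx_block !mul0mx !mulmx0 N0 N'0 !addr0 block_mx0.
- apply/diagonalizable_mxP; exists (block_mx P 0 0 P').
    by rewrite block_diag_mx_unit Pu.
  exists (row_mx d d'); rewrite diag_mx_row !mulmx_block.
  by rewrite !mul0mx !mulmx0 !addr0 !add0r dE d'E.
Qed.

Lemma sq0_diag_sum_split n k l (A : 'M[F]_n) (V : 'M_(k, n)) (W : 'M_(l, n)) :
    (k + l = n)%N -> stablemx V A -> stablemx W A -> row_free (col_mx V W) ->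
    (forall B : 'M[F]_k, sq0_diag_sum B) ->
    (forall B : 'M[F]_l, sq0_diag_sum B) ->
  sq0_diag_sum A.
Proof.
move=> nE; subst n => VA WA; rewrite row_free_unit => VWu PV PW.
(* The blocks are the matrices of [A] restricted to the row spaces of [V] and [W], with coordinates
   read by [pinvmx]. *)
pose B := block_mx (V *m A *m pinvmx V) 0 0 (W *m A *m pinvmx W).
apply: (@sq0_diag_sum_sim _ _ _ B VWu); last exact: sq0_diag_sum_block.
rewrite mul_col_mx mul_block_col !mul0mx addr0 add0r.
by rewrite !mulmxKpV.
Qed.

(** * Irreducible factors of polynomials *)

(** If [q] divides the cofactor [h] of [d], cancel one [q]; otherwise [h] is coprime to [q^(e+1)],
    which must then divide [d]. *)
Lemma dvdp_irreducible_exp (q d : {poly F}) e : irreducible_poly q ->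
  d %| q ^+ e.+1 -> (d %| q ^+ e) || (q ^+ e.+1 %| d).
Proof.
move=> q_irr /dvdpP[h qE]; have qn0 := irredp_neq0 q_irr.
have [/dvdpP[h' hE]|qNh] := boolP (q %| h).
  apply/orP; left; apply/dvdpP; exists h'; apply: (mulfI qn0).
  by rewrite -exprS qE hE; ring.
apply/orP; right; rewrite -(@Gauss_dvdpr _ d h); last first.
  by rewrite coprimep_expl // irreducible_poly_coprime.
by rewrite qE.
Qed.

(** Without an irreducible factor, [m] would itself be irreducible, since by induction a proper
    nonconstant divisor has one. *)
Lemma irreducible_factor (m : {poly F}) : (1 < size m)%N ->
  exists2 q, irreducible_poly q & q %| m.
Proof.
have [k] := ubnP (size m); elim: k m => // k IH m mk m_gt1.
apply: NNPP => no_factor; case: (no_factor); exists m => //; split=> // q q1 qm.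
have m0 : m != 0 by rewrite -size_poly_gt0 ltnW.
rewrite -dvdp_size_eqp // eqn_leq dvdp_leq //=; case: leqP => // qltm.
have q_gt1 : (1 < size q)%N.
  have: q != 0 by apply: contraNneq m0 => q0; rewrite q0 dvd0p in qm.
  by rewrite -size_poly_gt0; move: q1; lia.
have [|r r_irr rq] := IH q _ q_gt1; first exact: leq_trans qltm _.
by case: no_factor; exists r => //; apply: dvdp_trans qm.
Qed.

(** Copies of [q] move from [g] into the power until [q] no longer divides [g]. *)
Lemma primary_factorization (m : {poly F}) : (1 < size m)%N ->
  exists (q : {poly F}) e (g : {poly F}), [/\ irreducible_poly q, m = q ^+ e.+1 * g & coprimep q g].
Proof.
move=> m_gt1; have [q q_irr /dvdpP[g mE]] := irreducible_factor m_gt1.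
have: g != 0 by apply: contraTneq m_gt1 => g0; rewrite mE g0 mul0r size_poly0.
have {mE m_gt1}: m = q ^+ 1 * g by rewrite mE; ring.
move: (g : {poly F}) 0%N => {}g e; have [k] := ubnP (size g).
elim: k g e => // k IH g e gk mE g0.
have [/dvdpP[h hE]|qNg] := boolP (q %| g); last first.
  by exists q, e, g; rewrite irreducible_poly_coprime.
have h0 : h != 0 by apply: contraNneq g0 => h0; rewrite hE h0 mul0r.
apply: (IH h e.+1) => //; last by rewrite mE hE (mulrC h) mulrA -exprSr.
have lt_pred a b c : ((a + b).-1 < c.+1 -> 1 < b -> a < c)%N by lia.
apply: (lt_pred _ (size q)); last by case: q_irr.
by move: gk; rewrite hE size_mul ?(irredp_neq0 q_irr).
Qed.

(** * Krylov subspaces and their invariant complements *)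

Section Krylov.
Variables (n : nat) (A : 'M[F]_n.+1) (m : {poly F}) (k : nat) (v : 'rV[F]_n.+1).
Hypotheses (m_size : size m = k.+1) (mA : horner_mx A m = 0).
Hypothesis v_free :
  forall q : {poly F}, (size q <= k)%N -> v *m horner_mx A q = 0 -> q = 0.

Definition krylov : 'M[F]_(k, n.+1) := \matrix_(i < k) (v *m A ^+ i).

Lemma mul_krylov (c : 'rV_k) : c *m krylov = v *m horner_mx A (rVpoly c).
Proof.
rewrite mulmx_sum_row [rVpoly c]poly_def linear_sum /= mulmx_sumr.
apply: eq_bigr => i _; rewrite valK linearZ rmorphXn /= horner_mx_X rowK.
by rewrite scalemxAr.
Qed.

Lemma krylov_free : row_free krylov.
Proof.
apply/inj_row_free => c; rewrite mul_krylov => /v_free cE.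
by rewrite -[c]rVpolyK cE ?size_poly // linear0.
Qed.

Lemma horner_mx_modp (p : {poly F}) : horner_mx A p = horner_mx A (p %% m)%R.
Proof.
by rewrite {1}(divp_eq p m) rmorphD rmorphM /= mA mulr0 add0r.
Qed.

Lemma size_modp_annihilator (p : {poly F}) : (size (p %% m)%R <= k)%N.
Proof. by rewrite -ltnS -m_size ltn_modp -size_poly_gt0 m_size. Qed.

(** As [m] kills [A], only the remainder of [p] modulo [m] matters, and its degree is below [k]. *)
Lemma krylov_sub (p : {poly F}) : (v *m horner_mx A p <= krylov)%MS.
Proof.
rewrite horner_mx_modp -(poly_rV_K (size_modp_annihilator p)) -mul_krylov; exact: submxMl.
Qed.

Lemma krylov_stable : stablemx krylov A.
Proof.
apply/row_subP => i; rewrite row_mul rowK -mulmxA mulmxE -exprSr.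
by rewrite -{1}(horner_mx_X A) -rmorphXn krylov_sub.
Qed.

(* The complement is the set of vectors killed by all functionals [f o A^j],
   where [f] reads off the last Krylov coordinate. *)
Lemma krylov_complement : (0 < k)%N ->
  exists W : 'M[F]_n.+1,
    [/\ stablemx W A, (k + \rank W = n.+1)%N & row_free (col_mx krylov (row_base W))].
Proof.
move=> k_gt0; have ltk : (k.-1 < k)%N by rewrite prednK.
have [f fE] : exists f : 'cV_n.+1, krylov *m f = delta_mx (Ordinal ltk) 0.
  exists (pinvmx krylov *m delta_mx (Ordinal ltk) 0).
  by rewrite mulmxA mulmxVp ?krylov_free // mul1mx.
have coef_f (q : {poly F}) : (size q <= k)%N ->
    v *m horner_mx A q *m f = (q`_k.-1)%:M.
  move=> qk; rewrite -(poly_rV_K qk) -mul_krylov -mulmxA fE -colE.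
  by apply/rowP=> i; rewrite !mxE ord1 eqxx poly_rV_K.
pose L := \matrix_(i < n.+1, j < k) (A ^+ j *m f) i 0.
have colL (j : 'I_k) : col j L = A ^+ j *m f.
  by apply/colP=> i; rewrite !mxE.
have mulL r (u : 'M_(r, n.+1)) :
    u *m L = 0 <-> forall p : {poly F}, u *m horner_mx A p *m f = 0.
  split=> [uL p | uA]; last first.
    apply/matrixP => i j; have := uA 'X^j.
    rewrite rmorphXn /= horner_mx_X -mulmxA -colL colE mulmxA -colE => /colP/(_ i).
    by rewrite !mxE.
  rewrite horner_mx_modp -(poly_rV_K (size_modp_annihilator p)) [rVpoly _]poly_def.
  rewrite linear_sum /= mulmx_sumr mulmx_suml big1 // => i _.
  rewrite valK linearZ rmorphXn /= horner_mx_X -scalemxAr -scalemxAl -mulmxA.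
  by rewrite -colL colE mulmxA uL mul0mx scaler0.
have KL : row_free (krylov *m L).
  apply/inj_row_free => c; rewrite mulmxA mul_krylov => /mulL cA.
  have [//|c0] := eqVneq c 0; set q := rVpoly c in cA.
  have q0 : q != 0 by apply: contraNneq c0 => q0; rewrite -[c]rVpolyK -/q q0 linear0.
  have q_size : (size q <= k)%N by apply: size_poly.
  (* This power of [X] moves the leading coefficient of [q] to degree [k - 1], the one that [f]
     reads. *)
  have := cA 'X^(k - size q); rewrite -[v *m _ *m _]mulmxA mulmxE -rmorphM.
  rewrite coef_f; last first.
    by rewrite size_mulXn // subnK.
  rewrite coefMXn; have -> : (k.-1 < k - size q)%N = false.
    by rewrite -size_poly_gt0 in q0; move: q0; lia.
  have -> : (k.-1 - (k - size q) = (size q).-1)%N.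
    by rewrite -size_poly_gt0 in q0; move: q0 q_size; lia.
  move=> /matrixP/(_ 0 0)/eqP; rewrite !mxE mulr1n -lead_coefE lead_coef_eq0.
  by rewrite (negPf q0).
have rankL : \rank L = k.
  apply/eqP; rewrite eqn_leq rank_leq_col /=.
  by rewrite -{1}(eqP KL) mxrankM_maxr.
have capKW : (krylov :&: row_base (kermx L) = 0)%MS.
  apply/eqP/rowV0P => x; rewrite sub_capmx => /andP[/submxP[c ->]].
  rewrite eq_row_base => /sub_kermxP; rewrite -mulmxA => cKL.
  by have -> : c = 0; [apply: (row_free_injr KL) | ]; rewrite /= ?mul0mx.
exists (kermx L); split.
- apply/sub_kermxP/mulL => p; have /mulL kA : kermx L *m L = 0 by exact: mulmx_ker.
  have := kA ('X * p); rewrite rmorphM /= horner_mx_X -mulmxE => <-.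
  by rewrite !mulmxA.
- by rewrite mxrank_ker rankL subnKC // -rankL rank_leq_row.
- rewrite -row_leq_rank -addsmxE mxrank_disjoint_sum //; by rewrite eq_row_base (eqP krylov_free).
Qed.

End Krylov.

(** * Cyclic or decomposable matrices *)

(** If the minimal polynomial is, up to a scalar, a power of an irreducible [q], a vector not killed
    by the next lower power spans a Krylov space with an invariant complement; a zero complement
    means that [A] is cyclic. Otherwise the kernels of two coprime factors split the space. *)
Lemma cyclic_or_split n (A : 'M[F]_n.+1) :
  (exists v : 'rV_n.+1, forall q : {poly F}, (size q <= n.+1)%N ->
     v *m horner_mx A q = 0 -> q = 0) \/
  (exists k l (V : 'M[F]_(k, n.+1)) (W : 'M[F]_(l, n.+1)),
    [/\ (0 < k)%N, (0 < l)%N & (k + l)%N = n.+1] /\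
    [/\ stablemx V A, stablemx W A & row_free (col_mx V W)]).
Proof.
set m := mxminpoly A; have m0 : m != 0 by apply/monic_neq0/mxminpoly_monic.
have m_gt1 : (1 < size m)%N by rewrite size_mxminpoly ltnS mxminpoly_nonconstant.
have mA : horner_mx A m = 0 by exact: mx_root_minpoly.
(* By minimality of [m], the factor [b] of lower degree cannot kill [A]. *)
have proper_factor (a b : {poly F}) : m = a * b -> (1 < size a)%N ->
    horner_mx A b != 0.
  move=> mE a_gt1; rewrite -dvd_mxminpoly -/m; apply/negP => /dvdp_leq.
  have a0 : a != 0 by rewrite -size_poly_gt0 ltnW.
  have b0 : b != 0 by apply: contraNneq m0 => b0; rewrite mE b0 mulr0.
  have pred_gt x y : (1 < x -> 0 < y -> (x + y).-1 <= y -> False)%N by lia.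
  move=> /(_ b0); rewrite mE size_mul //; apply: pred_gt => //.
  by rewrite size_poly_gt0.
have [q [e [g [q_irr mE qg]]]] := primary_factorization m_gt1.
have q_gt1 : (1 < size q)%N by case: q_irr.
have q0 := irredp_neq0 q_irr.
have g0 : g != 0 by apply: contraNneq m0 => g0; rewrite mE g0 mulr0.
have [g1|g1] := eqVneq (size g) 1%N.
  have mq : m %= q ^+ e.+1.
    by rewrite mE -[X in _ %= X]mulr1 eqp_mull // -size_poly_eq1 g1.
  have qA : horner_mx A (q ^+ e.+1) = 0.
    by apply/eqP; rewrite -dvd_mxminpoly; case/andP: mq.
  have qeA : horner_mx A (q ^+ e) != 0.
    have : horner_mx A (q ^+ e * g) != 0.
      by apply: (proper_factor q); rewrite // mulrA -exprS.
    by apply: contraNneq => h; rewrite rmorphM /= h mul0r.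
  have [v vqe] : exists v : 'rV_n.+1, v *m horner_mx A (q ^+ e) != 0.
    have /rowV0Pn[_ /submxP[v ->] ?] := qeA; by exists v.
  have mS : size m = (size m).-1.+1 by rewrite prednK // ltnW.
  have v_free (r : {poly F}) : (size r <= (size m).-1)%N -> v *m horner_mx A r = 0 -> r = 0.
    move=> r_lt vr; apply/eqP; apply: contraNT vqe => r0.
    (* By Bezout the gcd [d] kills [v]. Either [d] divides [q^e], which then kills [v], or [q^(e+1)]
       divides [r], against the degree of [r]. *)
    have [[a b] /= /eqpP] := Bezoutp r (q ^+ e.+1).
    set d := gcdp _ _ => -[[c c'] /= /andP[c0 c'0] dE].
    have vd : v *m horner_mx A d = 0.
      apply: (scalerI c'0); rewrite scaler0 scalemxAr -linearZ /= -dE.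
      rewrite linearZ rmorphD !rmorphM /= qA mulr0 addr0.
      by rewrite -[_ * _]comm_horner_mx2 -mulmxE -scalemxAr mulmxA vr mul0mx scaler0.
    have := dvdp_irreducible_exp q_irr (dvdp_gcdr r (q ^+ e.+1)).
    rewrite -/d => /orP[/dvdpP[h ->]|].
      by rewrite mulrC rmorphM -mulmxE mulmxA vd mul0mx.
    move=> /dvdp_trans/(_ (dvdp_gcdl _ _))/(dvdp_leq r0).
    by rewrite -(eqp_size mq) leqNgt mS ltnS r_lt.
  have k_gt0 : (0 < (size m).-1)%N by rewrite -ltnS -mS.
  have [W [WA rkW freeW]] := krylov_complement mS mA v_free k_gt0.
  have [W0|W0] := posnP (\rank W).
    by left; exists v => r r_lt; apply: v_free; rewrite -[X in (_ <= X)%N]addn0 -W0 rkW.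
  right; exists (size m).-1, (\rank W), (krylov A (size m).-1 v), (row_base W).
  split=> //; split=> //; first exact: krylov_stable mS mA.
  by rewrite stablemx_row_base.
right; set V := kermxpoly A (q ^+ e.+1); set W := kermxpoly A g.
have cop : coprimep (q ^+ e.+1) g by rewrite coprimep_expl.
have capVW : (row_base V :&: row_base W = 0)%MS.
  apply/eqP/rowV0P => x; rewrite sub_capmx !eq_row_base -sub_capmx.
  by rewrite mxdirect_kermxpoly // submx0 => /eqP.
have VW : (V + W == 1)%MS.
  by apply/eqmxP/(eqmx_trans (eqmx_sym (kermxpolyM _ cop)))/kermxpoly_min; rewrite -mE.
have rkVW : (\rank V + \rank W = n.+1)%N.
  rewrite -mxrank_sum_cap mxdirect_kermxpoly // mxrank0 addn0.
  by rewrite (eqmxP VW) mxrank1.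
have ker_proper p : horner_mx A p != 0 -> (\rank (kermxpoly A p) < n.+1)%N.
  rewrite ltnNge /kermxpoly mxrank_ker -(mxrank_eq0 (horner_mx A p)).
  by move=> ?; lia.
have Vlt : (\rank V < n.+1)%N.
  apply/ker_proper/(proper_factor g); first by rewrite mulrC.
  by move: g1 g0; rewrite -size_poly_gt0; lia.
have Wlt : (\rank W < n.+1)%N.
  apply/ker_proper/(proper_factor (q ^+ e.+1)) => //.
  by rewrite -ltn_predRL size_exp muln_gt0 ltn_predRL q_gt1.
exists (\rank V), (\rank W), (row_base V), (row_base W); split; split=> //.
- by move: Wlt rkVW; lia.
- by move: Vlt rkVW; lia.
- by rewrite stablemx_row_base comm_mx_stable_kermxpoly.
- by rewrite stablemx_row_base comm_mx_stable_kermxpoly.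
- by rewrite -row_leq_rank -addsmxE mxrank_disjoint_sum // !eq_row_base.
Qed.

(** * Newton basis and Hessenberg form *)

Definition newton_poly (d : nat -> F) (k : nat) : {poly F} :=
  \prod_(j < k) ('X - (d j)%:P).

Lemma size_newton_poly d k : size (newton_poly d k) = k.+1.
Proof. by rewrite size_prod_XsubC /index_enum -enumT size_enum_ord. Qed.

Lemma newton_poly_monic d k : newton_poly d k \is monic.
Proof. exact: monic_prod_XsubC. Qed.

Lemma newton_polyS d k :
  newton_poly d k.+1 = newton_poly d k * ('X - (d k)%:P).
Proof. exact: big_ord_recr. Qed.

Lemma size_sum_newton_poly d k (c : nat -> F) :
  (size (\sum_(i < k) c i *: newton_poly d i)%R <= k)%N.
Proof.
apply: (leq_trans (size_sum _ _ _)); apply/bigmax_leqP => i _.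
by apply: (leq_trans (size_scale_leq _ _)); rewrite size_newton_poly.
Qed.

(** The degrees increase strictly, so the top coefficient isolates the last [c]. *)
Lemma newton_poly_free d k (c : nat -> F) :
  \sum_(i < k) c i *: newton_poly d i = 0 -> forall i, (i < k)%N -> c i = 0.
Proof.
elim: k => // k IH; rewrite big_ord_recr /= => sum0.
have ck0 : c k = 0.
  have /(congr1 (fun p : {poly F} => p`_k)) := sum0.
  rewrite coefD coefZ nth_default ?size_sum_newton_poly // add0r coef0.
  have /monicP := newton_poly_monic d k.
  by rewrite lead_coefE size_newton_poly /= => ->; rewrite mulr1.
move: sum0; rewrite ck0 scale0r addr0 => /IH c0 i.
by rewrite ltnS leq_eqVlt => /predU1P[->|/c0].
Qed.

(* In the Newton basis [v * prod_(j < i) (A - d j)] the matrix has a prescribed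
   diagonal, except for its last entry, which the trace determines. *)
Lemma cyclic_hessenberg n (A : 'M[F]_n.+1) (v : 'rV_n.+1) (d : nat -> F) :
    (forall q : {poly F}, (size q <= n.+1)%N -> v *m horner_mx A q = 0 -> q = 0) ->
  exists U M : 'M[F]_n.+1,
    [/\ U \in unitmx, U *m A = M *m U,
        forall i j : 'I_n.+1, (i < n)%N -> M i j = d i *+ (i == j) + (j == i.+1 :> nat)%:R
      & M ord_max ord_max = \tr A - \sum_(i < n) d i].
Proof.
move=> v_free; pose U := \matrix_(i < n.+1) (v *m horner_mx A (newton_poly d i)).
have Uu : U \in unitmx.
  rewrite -row_free_unit; apply/inj_row_free => c; rewrite mulmx_sum_row => cU.
  pose c' i := c 0 (inord i); apply/rowP => i; rewrite mxE.
  have <- : c' i = c 0 i by rewrite /c' inord_val.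
  apply: (@newton_poly_free d n.+1 c') => //.
  apply: v_free; first exact: size_sum_newton_poly.
  rewrite linear_sum /= mulmx_sumr -[RHS]cU; apply: eq_bigr => j _.
  by rewrite linearZ rowK scalemxAr /c' inord_val.
have rowU (i : 'I_n.+1) : row i U *m invmx U = delta_mx 0 i.
  by rewrite -row_mul mulmxV // row1.
have Mrow (i j : 'I_n.+1) : (i < n)%N ->
    (U *m A *m invmx U) i j = d i *+ (i == j) + (j == i.+1 :> nat)%:R.
  move=> i_lt; have i1_lt : (i.+1 < n.+1)%N by [].
  (* Each Newton vector times [A - d i] is the next one. *)
  have rowUA : row i U *m A = d i *: row i U + row (Ordinal i1_lt) U.
    rewrite !rowK /= newton_polyS mulrBr rmorphB !rmorphM /= horner_mx_X.
    rewrite horner_mx_C -mulmxE mulmxBr mul_mx_scalar -scalemxAr.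
    by rewrite addrC subrK mulmxA.
  transitivity ((row i (U *m A *m invmx U)) 0 j); first by rewrite [RHS]mxE.
  rewrite !row_mul rowUA mulmxDl -scalemxAl !rowU !mxE /= mulr_natr.
  by rewrite eq_sym.
exists U, (U *m A *m invmx U); split=> //; first by rewrite mulmxKV.
have : \tr (U *m A *m invmx U) = \tr A by rewrite mxtrace_mulC mulKmx.
rewrite {1}/mxtrace big_ord_recr /= => <-.
rewrite (eq_bigr (fun i : 'I_n => d i)); first by rewrite addrAC subrr add0r.
move=> i _; by rewrite Mrow /= ?ltn_ord // eqxx mulr1n ltn_eqF // addr0.
Qed.

(* The indices of one parity form a class [O], those with the parity of the last
   index a class [L].  [N] is the (L, O) block of [M]; the rest is block
   triangular with disjoint spectra on the diagonal. *)
Lemma sq0_diag_sum_hessenberg n (M : 'M[F]_n.+1) (d : nat -> F) (rO rL : seq F) :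
    (forall i j : 'I_n.+1, (i < n)%N -> M i j = d i *+ (i == j) + (j == i.+1 :> nat)%:R) ->
    uniq (rO ++ M ord_max ord_max :: rL) ->
    (forall i, (i < n)%N -> d i \in if odd (n - i) then rO else rL) ->
  sq0_diag_sum M.
Proof.
move=> Mij r_uniq d_in; set e := M _ _ in r_uniq.
pose O (i : 'I_n.+1) := odd (n - i).
have notO_max : O ord_max = false by rewrite /O subnn.
pose N := \matrix_(i, j) (if ~~ O i && O j then M i j else 0).
pose D := M - N.
pose P (s : seq F) := \prod_(x <- s) ('X - x%:P).
have kill_dvd (w : 'rV_n.+1) (p q : {poly F}) :
    p %| q -> w *m horner_mx D p = 0 -> w *m horner_mx D q = 0.
  by move=> /dvdpP[h ->] wp; rewrite mulrC rmorphM -mulmxE mulmxA wp mul0mx.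
(* Here [w] times [D - r] is [w']: one linear factor passes from [w] to [w'], which climbs the
   triangular structure of [D]. *)
have kill_step (w w' : 'rV_n.+1) r p :
    w *m D = r *: w + w' -> w' *m horner_mx D p = 0 ->
    w *m horner_mx D (('X - r%:P) * p) = 0.
  move=> wD w'p; rewrite rmorphM rmorphB /= horner_mx_X horner_mx_C -mulmxE.
  by rewrite mulmxA mulmxBr wD mul_mx_scalar addrAC subrr add0r.
have dvd_P x s : x \in s -> 'X - x%:P %| P s by rewrite dvdp_XsubCl root_prod_XsubC.
have Dij (i j : 'I_n.+1) : (i < n)%N ->
    D i j = d i *+ (i == j) + (O i && (j == i.+1 :> nat))%:R.
  move=> i_lt; rewrite !mxE Mij //; have [Oi|NOi] /= := boolP (O i).
    by rewrite subr0.
  have [Oj|NOj] := boolP (O j).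
    have -> : i == j = false by apply: contraTF Oj => /eqP <-.
    by rewrite subrr add0r.
  (* Parity alternates, so [i] and [i + 1] cannot both lie outside [O]. *)
  rewrite subr0; congr (_ + _); case: eqP => // ji; move: NOi NOj.
  by rewrite /O ji; move: i_lt; lia.
pose ev (i : 'I_n.+1) : 'rV[F]_n.+1 := delta_mx 0 i.
(* Rows of class [L] before the last have lost their 1 to [N], so these basis vectors are
   eigenvectors of [D]. *)
have killL (i : 'I_n.+1) : (i < n)%N -> ~~ O i -> ev i *m horner_mx D (P rL) = 0.
  move=> i_lt NOi; have := d_in i i_lt; rewrite -/(O i) (negPf NOi) => /dvd_P dP.
  apply: kill_dvd dP _; rewrite -['X - _]mulr1; apply: (kill_step _ 0).
    rewrite -rowE; apply/rowP=> j; rewrite mxE Dij // (negPf NOi) !mxE /=.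
    by rewrite !addr0 mulr_natr eq_sym.
  by rewrite mul0mx.
(* The last row of [D] is supported on its own class; the factor of [e] reduces it to the
   eigenvectors of [killL]. *)
have kill_max : ev ord_max *m horner_mx D (P (e :: rL)) = 0.
  rewrite /P big_cons; apply: (kill_step _ (\sum_(j < n.+1 | (j < n)%N) D ord_max j *: ev j)).
    rewrite -rowE [LHS]row_sum_delta (bigD1 ord_max) //=; congr (_ *: _ + _).
      by rewrite !mxE notO_max subr0.
    apply: eq_big => [j|j _]; last by rewrite mxE.
    by rewrite -val_eqE /= ltn_neqAle -ltnS ltn_ord andbT.
  rewrite mulmx_suml big1 // => j j_lt; rewrite -scalemxAl.
  have [Oj|NOj] := boolP (O j); last by rewrite killL // scaler0.
  by rewrite !mxE notO_max Oj subrr scale0r.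
have killNO (i : 'I_n.+1) : ~~ O i -> ev i *m horner_mx D (P (e :: rL)) = 0.
  have [i_lt NOi|i_ge _] := ltnP i n.
    by apply: kill_dvd (killL i i_lt NOi); rewrite /P big_cons dvdp_mull.
  suff -> : i = ord_max by [].
  by apply/val_inj/eqP; rewrite /= eqn_leq i_ge -ltnS ltn_ord.
have kill_all (i : 'I_n.+1) : ev i *m horner_mx D (P (rO ++ e :: rL)) = 0.
  have -> : P (rO ++ e :: rL) = P rO * P (e :: rL) by exact: big_cat.
  have [Oi|NOi] := boolP (O i); last first.
    by apply: kill_dvd (killNO i NOi); rewrite dvdp_mull.
  have i_lt : (i < n)%N by move: Oi; rewrite /O; lia.
  have i1_lt : (i.+1 < n.+1)%N by [].
  have := d_in i i_lt; rewrite -/(O i) Oi => /dvd_P dP.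
  apply: kill_dvd (dvdp_mul dP (dvdpp _)) _.
  apply: (kill_step _ (ev (Ordinal i1_lt))).
    rewrite -rowE; apply/rowP=> j; rewrite mxE Dij // Oi !mxE /=.
    by rewrite mulr_natr eq_sym.
  by apply: killNO; move: Oi; rewrite /O /=; lia.
exists N, D; split; first by rewrite /D addrC subrK.
  apply/matrixP => i k; rewrite !mxE big1 // => j _; rewrite !mxE.
  by case: (O j); rewrite ?andbF ?mul0r ?mulr0.
(* A product of distinct linear factors kills [D], which is therefore diagonalizable. *)
have [|Q Qu /diagonalizable_forPex[q /(simmxP Qu) QD]] := (diagonalizableP D).2; last first.
  by apply/diagonalizable_mxP; exists Q => //; exists q.
exists (rO ++ e :: rL) => //; apply/mxminpoly_minP/row_matrixP => i.
by rewrite rowE kill_all row0.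
Qed.



End Decomposition.

(** * Choice of the diagonal in characteristic 2 *)

Section CharacteristicTwo.
Variable F : finFieldType.
Hypotheses (F2 : 2%N \in [pchar F]) (F4 : (4 <= #|F|)%N).

Lemma exists_notin (s : seq F) : (size s <= 3)%N -> exists x, x \notin s.
Proof.
move=> s3; apply/existsP; apply: contraTT (leq_ltn_trans s3 F4).
rewrite negb_exists -leqNgt => /forallP s_all.
apply: leq_trans (card_size s); apply/subset_leq_card/subsetP => x _.
by have := s_all x; rewrite negbK.
Qed.

Lemma mulrn_pchar2 (x : F) m : x *+ m = if odd m then x else 0.
Proof.
rewrite -{1}(odd_double_half m) mulrnDr -muln2 mulrnA mulr2n addrr_pchar2 //.
by rewrite addr0; case: odd.
Qed.

Lemma sum_alternating (a b : F) m :
  \sum_(i < m.*2) (if odd i then a else b) = (a + b) *+ m.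
Proof.
elim: m => [|m IH]; first by rewrite big_ord0.
by rewrite doubleS !big_ord_recr IH /= odd_double /= mulrSr -addrA (addrC b).
Qed.

(* [rO] and [rL] list the values of [d] on the two parity classes of the indices
   [i < n]; the last diagonal entry is what the trace [t] leaves. *)
Definition splitting_diagonal n (t : F) (d : nat -> F) (rO rL : seq F) :=
  uniq (rO ++ (t - \sum_(i < n) d i) :: rL) /\
  forall i, (i < n)%N -> d i \in if odd (n - i) then rO else rL.

(** Alternating [a] and [b] leaves [t] or [t + a + b] as last entry; the latter is [a] or [b] only
    if [t] is [b] or [a]. *)
Lemma splitting_diagonal_even m (t : F) :
  exists d rO rL, splitting_diagonal m.*2 t d rO rL.
Proof.
have [a a_t] := @exists_notin [:: t] isT.
have [b b_ta] := @exists_notin [:: t; a] isT.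
exists (fun i => if odd i then a else b), [:: a], [:: b]; split; last first.
  move=> i i_lt; rewrite oddB 1?ltnW // odd_double /=.
  by case: odd; rewrite mem_head.
rewrite sum_alternating mulrn_pchar2.
move: a_t b_ta; rewrite /= !inE !negb_or !andbT => a_t /andP[b_t b_a].
rewrite [a == b]eq_sym b_a andbT [a == _]eq_sym !subr_eq.
case: odd; last by rewrite !addr0 ![t == _]eq_sym a_t b_t.
rewrite addrA addrr_pchar2 // add0r (addrC a) addrA addrr_pchar2 // add0r.
by rewrite ![t == _]eq_sym a_t b_t.
Qed.

(** Alternating 0 and [b] leaves [t] or [t - b], which avoid 0 and [b] because [t] is neither of
    these. *)
Lemma splitting_diagonal_odd m (t : F) : t != 0 ->
  exists d rO rL, splitting_diagonal m.*2.+1 t d rO rL.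
Proof.
move=> t0; have [b b_t0] := @exists_notin [:: t; 0] isT.
exists (fun i => if odd i then b else 0), [:: 0], [:: b]; split; last first.
  move=> i i_lt; rewrite oddB 1?ltnW //= odd_double /=.
  by case: odd; rewrite mem_head.
rewrite big_ord_recr /= sum_alternating odd_double !addr0 mulrn_pchar2.
move: b_t0; rewrite /= !inE !negb_or !andbT => /andP[b_t b0].
rewrite [0 == b]eq_sym b0 andbT [0 == _]eq_sym !subr_eq add0r.
case: odd; last by rewrite !addr0 t0 eq_sym b_t.
by rewrite addrr_pchar2 // t0 eq_sym b_t.
Qed.

(* With the constants 0 and 1 on the two classes, the missing entry would repeat
   one of them; replacing one entry of the even-sized class by [x] turns the
   missing entry into [x + 1]. *)
Lemma splitting_diagonal_trace0 m : (0 < m)%N ->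
  exists d rO rL, splitting_diagonal m.*2.+1 0 d rO rL.
Proof.
move=> m_gt0; have [x x01] := @exists_notin [:: 0; 1] isT.
(* There are [m + 1] even and [m] odd indices, so [i0] lies in the class of even size. *)
pose i0 : nat := ~~ odd m; have i0_lt : (i0 < m.*2.+1)%N.
  by rewrite /i0; case: (odd m) => //=; rewrite ltnS double_gt0.
pose d i : F := (if odd i then 1 else 0) + (if i == i0 then x - (odd i0)%:R else 0).
have d_i0 : d i0 = x.
  by rewrite /d eqxx; case: (odd i0); rewrite ?subr0 ?add0r // addrC subrK.
have d_sum : \sum_(i < m.*2.+1) d i = x + 1.
  rewrite big_split /= big_ord_recr /= sum_alternating odd_double !addr0.
  rewrite (bigD1 (Ordinal i0_lt)) //= eqxx big1 => [|i ne]; last first.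
    by rewrite -val_eqE /= in ne; rewrite (negPf ne).
  rewrite mulrn_pchar2 /i0 addr0 oddb.
  by case: (odd m); [rewrite subr0 addrC | rewrite add0r oppr_pchar2].
have d_ne i : (i == i0) = false -> d i = if odd i then 1 else 0.
  by rewrite /d => ->; rewrite addr0.
clearbody d; exists d, (if odd m then [:: 0; x] else [:: 0]), (if odd m then [:: 1] else [:: x; 1]).
split; last first.
  move=> i i_lt; rewrite oddB 1?ltnW //= odd_double /=.
  have [->|/negPf i_ne] := eqVneq i i0.
    by rewrite d_i0 /i0 oddb; case: (odd m); rewrite /= !inE eqxx ?orbT.
  by rewrite d_ne //; case: (odd m); case: (odd i); rewrite !inE eqxx ?orbT.
rewrite d_sum sub0r oppr_pchar2 //.
have x1_x : (x + 1 == x) = false by rewrite -subr_eq0 addrAC subrr add0r oner_eq0.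
have x1_1 : (x + 1 == 1) = (x == 0) by rewrite -subr_eq0 addrK.
have x1_0 : (x + 1 == 0) = (x == 1) by rewrite addr_eq0 oppr_pchar2.
move: x01; rewrite !inE negb_or => /andP[/negPf x0 /negPf x1].
have o0 : (0 == 1 :> F) = false by rewrite eq_sym oner_eq0.
by case: (odd m); rewrite /= !inE !(eq_sym 0) ?(eq_sym x (x + 1)) ?x1_x ?x1_1 ?x1_0 ?x0 ?x1 ?oner_eq0.
Qed.

(** * Square roots and the exceptional case of size 2 *)

(** Frobenius is injective, hence bijective on a finite field. *)
Lemma sqrt_exists (z : F) : exists c, c ^+ 2 = z.
Proof.
have inj : injective (pFrobenius_aut F2) by apply: fmorph_inj.
have [g _ gK] := injF_bij inj.
by exists (g z); rewrite -[RHS]gK.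
Qed.

Lemma sq0_diag_sum_trace0 (A : 'M[F]_2) : \tr A = 0 -> sq0_diag_sum A.
Proof.
(* The radicand is the determinant of [A]: trace zero makes the diagonal entries equal in
   characteristic 2. *)
move=> trA; have [c cE] := sqrt_exists (A 0 0 ^+ 2 + A 0 1 * A 1 0).
exists (A - c%:M), c%:M; split; first by rewrite subrK.
  have ord2 (i : 'I_2) : i = 0 \/ i = 1.
    by case: i => [[|[|?]] ?] //; [left | right]; apply: val_inj.
  have lift01 : lift ord0 (@ord0 0) = 1 :> 'I_2 by apply: val_inj.
  have A11 : A 1 1 = A 0 0.
    move: trA; rewrite /mxtrace !big_ord_recl big_ord0 addr0 lift01.
    by move/eqP; rewrite addr_eq0 oppr_pchar2 // => /eqP.
  have AA : A *m A = (c ^+ 2)%:M.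
    apply/matrixP => i j; rewrite cE !mxE !big_ord_recl big_ord0 addr0 lift01.
    have [-> | ->] := ord2 i; have [-> | ->] := ord2 j; rewrite /= ?A11.
    - by rewrite mulr1n expr2.
    - by rewrite mulrC -mulrDr addrr_pchar2 // mulr0.
    - by rewrite mulrC -mulrDl addrr_pchar2 // mul0r.
    - by rewrite mulr1n expr2 addrC (mulrC (A 1 0)).
  rewrite mulmxBl !mulmxBr AA -scalar_mxM -expr2 mul_scalar_mx mul_mx_scalar.
  by rewrite opprB -mulr2n -scaler_nat (pcharf0 F2) scale0r.
apply/diagonalizable_mxP; exists 1%:M; first exact: unitmx1.
by exists (const_mx c); rewrite diag_const_mx mul1mx mulmx1.
Qed.

(* In dimension 2 with trace 0 a diagonalizable summand must have a double
   eigenvalue, hence be scalar; all other cyclic matrices have a Hessenberg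
   form with a splitting diagonal. *)
Lemma sq0_diag_sum_cyclic n (A : 'M[F]_n.+1) (v : 'rV_n.+1) :
    (forall q : {poly F}, (size q <= n.+1)%N -> v *m horner_mx A q = 0 -> q = 0) ->
  sq0_diag_sum A.
Proof.
move=> v_free.
have [[n1 trA] | [d [rO [rL [r_uniq d_in]]]]] :
    (n = 1%N /\ \tr A = 0) \/ exists d rO rL, splitting_diagonal n (\tr A) d rO rL.
  move: (\tr A) (odd_double_half n) => t; move: n./2 => m.
  case: (odd n) => <-; last by right; apply: splitting_diagonal_even.
  have [t0|t0] := eqVneq t 0; last by right; apply: splitting_diagonal_odd.
  have [-> | m_gt0] := posnP m; [by left | right; rewrite t0].
  exact: splitting_diagonal_trace0.
- by subst n; apply: sq0_diag_sum_trace0.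
have [U [M [Uu UA Mij Mmax]]] := cyclic_hessenberg d v_free.
apply: (sq0_diag_sum_sim Uu UA); apply: (sq0_diag_sum_hessenberg Mij) d_in.
by rewrite Mmax.
Qed.

(** * Induction on the dimension *)

Lemma sq0_diag_sum_all n (A : 'M[F]_n) : (0 < n)%N -> sq0_diag_sum A.
Proof.
have [k] := ubnP n; elim: k n A => // k IH [//|n] A n_lt _.
have [[v v_free] | [i [j [V [W [[i0 j0 ijE] [VA WA VW]]]]]]] := cyclic_or_split A.
  exact: sq0_diag_sum_cyclic v_free.
by apply: (sq0_diag_sum_split ijE VA WA VW) => B; apply: IH => //; lia.
Qed.
End CharacteristicTwo.

Theorem theorem3p1 (F : finFieldType) (n : nat) :
  2%N \in [pchar F] -> (4 <= #|F|)%N -> (1 <= n)%N ->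
  forall A : 'M[F]_n,
    exists N D : 'M[F]_n,
      [/\ A = N + D, N *m N = 0 & diagonalizable_mx D].
Proof. by move=> F2 F4 n_gt0 A; apply: sq0_diag_sum_all. Qed.
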